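(* For every integer $n \ge 3$, the twin group $T_n$ is not co-Hopfian; that is, there exists an injective group endomorphism of $T_n$ which is not an automorphism.
   Context: For $n \ge 2$, the twin group $T_n$ is the group with presentation $$T_n=\langle s_1, \dots, s_{n-1} \mid s_i^2 = 1 \ (1 \le i \le n-1),\ s_i s_j = s_j s_i \text{ for } |i-j| \ge 2 \rangle.$$ A group is co-Hopfian if every injective endomorphism of it is an automorphism. *)

(* Defs.v *)
From HB Require Import structures.
From mathcomp Require Import all_boot.
From mathcomp Require Import boolp.

Set Implicit Arguments.
Unset Strict Implicit.
Unset Printing Implicit Defensive.

Local Open Scope group_scope.
Local Open Scope quotient_scope.

(* (x, false) stands for the generator x, and (x, true) for its inverse. *)
Notation letter X := (X * bool)%type.
Notation word X := (seq (letter X)).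

Definition pos_letter (X : Type) (x : X) : letter X := (x, false).
Definition inv_letter (X : Type) (l : letter X) : letter X := (l.1, ~~ l.2).
Definition inv_word (X : Type) (u : word X) : word X :=
  rev (map (@inv_letter X) u).

(* The least congruence on words that contains the free cancellations and the
   equations u = v for which R u v holds. *)
Inductive presented_eq (X : Type) (R : word X -> word X -> Prop) :
    word X -> word X -> Prop :=
| presented_refl u : presented_eq R u u
| presented_sym u v : presented_eq R u v -> presented_eq R v u
| presented_trans u v w :
    presented_eq R u v -> presented_eq R v w -> presented_eq R u w
| presented_cat u u' v v' :
    presented_eq R u u' -> presented_eq R v v' ->
    presented_eq R (u ++ v) (u' ++ v')
| presented_cancel l : presented_eq R [:: l; inv_letter l] [::]
| presented_rel u v : R u v -> presented_eq R u v.

Section PresentedGroup.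
Variables (X : choiceType) (R : word X -> word X -> Prop).

Definition presented_eqb : rel (word X) :=
  fun u v => `[< presented_eq R u v >].

Lemma presented_eqb_refl : reflexive presented_eqb.
Proof. by move=> u; apply/asboolP; exact: presented_refl. Qed.

Lemma presented_eqb_sym : symmetric presented_eqb.
Proof. by move=> u v; apply/asboolP/asboolP; exact: presented_sym. Qed.

Lemma presented_eqb_trans : transitive presented_eqb.
Proof.
move=> v u w /asboolP uv /asboolP vw; apply/asboolP.
exact: presented_trans uv vw.
Qed.

Canonical presented_equiv :=
  EquivRel presented_eqb
    presented_eqb_refl presented_eqb_sym presented_eqb_trans.

(* The group < X | R >. *)
Definition presented_group := {eq_quot presented_equiv}.

HB.instance Definition _ := Choice.on presented_group.
HB.instance Definition _ := EqQuotient.on presented_group.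

Lemma presented_piP (u v : word X) :
  \pi_presented_group u = \pi_presented_group v <-> presented_eq R u v.
Proof. by split=> [/eqmodP/asboolP | uv]; last by apply/eqmodP/asboolP. Qed.

Lemma presented_reprP (u : word X) :
  presented_eq R (repr (\pi_presented_group u)) u.
Proof. by apply/presented_piP; rewrite reprK. Qed.

Lemma inv_letterK : involutive (@inv_letter X).
Proof. by case=> x b; rewrite /inv_letter negbK. Qed.

Lemma inv_word_cons (l : letter X) (u : word X) :
  inv_word (l :: u) = inv_word u ++ [:: inv_letter l].
Proof. by rewrite /inv_word map_cons rev_cons cats1. Qed.

Lemma inv_wordK : involutive (@inv_word X).
Proof.
by move=> u; rewrite /inv_word map_rev revK -map_comp (eq_map inv_letterK) map_id.
Qed.

Lemma presented_mulV (u : word X) :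
  presented_eq R (u ++ inv_word u) [::].
Proof.
elim: u => [|l u IHu]; first exact: presented_refl.
rewrite inv_word_cons -cat1s -!catA.
apply: presented_trans (presented_cancel R l).
apply: (@presented_cat _ _ [:: l] [:: l] _ [:: inv_letter l]).
  exact: presented_refl.
rewrite catA -[X in presented_eq _ _ X]cat0s.
by apply: presented_cat => //; exact: presented_refl.
Qed.

Lemma presented_inv (u v : word X) :
  presented_eq R u v -> presented_eq R (inv_word u) (inv_word v).
Proof.
move=> uv; apply: (@presented_trans _ _ _ (inv_word u ++ v ++ inv_word v)).
  rewrite -[X in presented_eq _ X _]cats0.
  apply: presented_cat; first exact: presented_refl.
  by apply: presented_sym; exact: presented_mulV.
rewrite catA -[X in presented_eq _ _ X]cat0s.
apply: presented_cat; last exact: presented_refl.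
apply: presented_trans (presented_mulV (inv_word u)).
rewrite inv_wordK; apply: presented_cat; first exact: presented_refl.
exact: presented_sym.
Qed.

Definition presented_one : presented_group := \pi_presented_group [::].
Definition presented_mul := lift_op2 presented_group (@cat (letter X)).
Definition presented_invg := lift_op1 presented_group (@inv_word X).

Lemma pi_presented_mul :
  {morph \pi_presented_group : u v / u ++ v >-> presented_mul u v}.
Proof.
move=> u v; unlock presented_mul; apply/presented_piP/presented_sym.
by apply: presented_cat; exact: presented_reprP.
Qed.

Lemma pi_presented_invg :
  {morph \pi_presented_group : u / inv_word u >-> presented_invg u}.
Proof.
move=> u; unlock presented_invg; apply/presented_piP/presented_sym.
by apply: presented_inv; exact: presented_reprP.
Qed.

Lemma presented_mulgA : associative presented_mul.
Proof.
elim/quotW=> u; elim/quotW=> v; elim/quotW=> w.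
by rewrite -!pi_presented_mul catA.
Qed.

Lemma presented_mul1g : left_id presented_one presented_mul.
Proof. by elim/quotW=> u; rewrite -pi_presented_mul. Qed.

Lemma presented_mulg1 : right_id presented_one presented_mul.
Proof. by elim/quotW=> u; rewrite -pi_presented_mul cats0. Qed.

Lemma presented_mulgV :
  right_inverse presented_one presented_invg presented_mul.
Proof.
elim/quotW=> u; rewrite -pi_presented_invg -pi_presented_mul.
by apply/presented_piP; exact: presented_mulV.
Qed.

Lemma presented_mulVg :
  left_inverse presented_one presented_invg presented_mul.
Proof.
elim/quotW=> u; rewrite -pi_presented_invg -pi_presented_mul.
apply/presented_piP; rewrite -[X in _ ++ X]inv_wordK; exact: presented_mulV.
Qed.

HB.instance Definition _ := isGroup.Build presented_group
  presented_mulgA presented_mul1g presented_mulg1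
  presented_mulVg presented_mulgV.

End PresentedGroup.

(* The index i : 'I_n.-1 stands for the generator s_(i+1). *)
Inductive twin_rel (n : nat) : word 'I_n.-1 -> word 'I_n.-1 -> Prop :=
| twin_square (i : 'I_n.-1) :
    twin_rel [:: pos_letter i; pos_letter i] [::]
| twin_commute (i j : 'I_n.-1) : (i.+2 <= j) || (j.+2 <= i) ->
    twin_rel [:: pos_letter i; pos_letter j] [:: pos_letter j; pos_letter i].

Definition twin_group (n : nat) : groupType := presented_group (@twin_rel n).

(* Between groups, {multiplicative _ -> _} is the type of homomorphisms, and a
   bijective endomorphism is an automorphism. *)
Definition co_hopfian (G : groupType) : Prop :=
  forall f : {multiplicative G -> G}, injective f -> bijective f.

(* Main.v *)
Require Import Defs.
From mathcomp Require Import all_boot.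
From HB Require Import structures.

Set Implicit Arguments.
Unset Strict Implicit.
Unset Printing Implicit Defensive.

(** The endomorphism f sends s_2 to s_2 s_1 s_2 and fixes the other generators.
    It is not surjective, because its image lies in the kernel of the character
    that sends s_2 to -1 and the other generators to 1.  For injectivity, let
    T_n act on two copies of itself through the homomorphism h into the wreath
    product of T_n by Z/2 given by
      s_1 |-> (s_1, s_2),  s_2 |-> swap,  s_3 |-> (s_3, 1),
      s_j |-> (s_j, s_j)  for j >= 4.
    Since h (f s_2) = swap (s_1, s_2) swap = (s_2, s_1), the first component
    of h (f w) is w for every w in T_n. *)

Local Open Scope group_scope.
Local Open Scope quotient_scope.

(** The condition on inverse letters, imposed at every letter, handles the free cancellations. Words
    can thus be compared through their effect on a plain type, without building a group of
    permutations. *)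
Lemma presented_eq_foldr (X : Type) (R : word X -> word X -> Prop) (T : Type)
    (act : letter X -> T -> T) (u v : word X) :
  (forall l, cancel (act (inv_letter l)) (act l)) ->
  (forall u v, R u v -> forall x, foldr act x u = foldr act x v) ->
  presented_eq R u v -> forall x, foldr act x u = foldr act x v.
Proof.
move=> actK actR; elim=> {u v} //=.
- by move=> u v w _ uv _ vw x; rewrite uv vw.
- by move=> u u' v v' _ uu _ vv x; rewrite !foldr_cat vv uu.
Qed.

Section TwinGroup.
Variable m : nat.

Local Notation T := (twin_group m.+3).
Local Notation I := 'I_m.+2.
Local Notation R := (@twin_rel m.+3).
Local Notation pi := (\pi_(presented_group R)).

(* Ordinals start at 0, so i0 and i1 are the indices of s_1 and s_2. *)
Let i0 : I := ord0.
Let i1 : I := Ordinal (isT : 1 < m.+2).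

Definition twin_gen (i : I) : T := pi [:: pos_letter i].

Lemma twin_pi_cat (u v : word I) : pi (u ++ v) = (pi u : T) * pi v.
Proof. exact: pi_presented_mul. Qed.

Lemma twin_pi_nil : pi [::] = 1 :> T.
Proof. by []. Qed.

Lemma twin_genK (i : I) : twin_gen i * twin_gen i = 1.
Proof.
rewrite -twin_pi_cat -twin_pi_nil.
by apply/presented_piP/presented_rel/twin_square.
Qed.

Lemma twin_gen_comm (i j : I) : (i.+2 <= j) || (j.+2 <= i) ->
  twin_gen i * twin_gen j = twin_gen j * twin_gen i.
Proof.
move=> ij; rewrite -!twin_pi_cat.
by apply/presented_piP/presented_rel/twin_commute.
Qed.

Lemma twin_pi_letter (l : letter I) : pi [:: l] = twin_gen l.1 :> T.
Proof.
case: l => i [] //=; rewrite -[LHS]mulg1 -(twin_genK i) mulgA -twin_pi_cat.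
have -> : pi ([:: (i, true)] ++ [:: pos_letter i]) = 1 :> T.
  by rewrite -twin_pi_nil; apply/presented_piP/(presented_cancel R (i, true)).
by rewrite mul1g.
Qed.

Lemma twin_eq_foldr (S : Type) (act : I -> S -> S) (u v : word I) :
  (forall i, involutive (act i)) ->
  (forall i j : I, i.+2 <= j -> forall x, act i (act j x) = act j (act i x)) ->
  presented_eq R u v ->
  forall x, foldr (fun l => act l.1) x u = foldr (fun l => act l.1) x v.
Proof.
move=> actK actC; apply: presented_eq_foldr => [l x|_ _ [i|i j] /=].
- exact: actK.
- by move=> x; rewrite actK.
- by case/orP=> ij x; rewrite (actC _ _ ij).
Qed.

Definition endo_letter (i : I) : word I :=
  if i == i1 then [:: pos_letter i1; pos_letter i0; pos_letter i1]
  else [:: pos_letter i].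

Definition endo_word (u : word I) : word I :=
  flatten [seq endo_letter l.1 | l <- u].

Lemma endo_word_cat (u v : word I) :
  endo_word (u ++ v) = endo_word u ++ endo_word v.
Proof. by rewrite /endo_word map_cat flatten_cat. Qed.

Lemma pi_endo_letter (i : I) :
  pi (endo_letter i) =
  if i == i1 then twin_gen i1 * twin_gen i0 * twin_gen i1 else twin_gen i.
Proof. by rewrite /endo_letter; case: ifP => // _; rewrite -!twin_pi_cat. Qed.

Lemma pi_endo_letterK (i : I) :
  (pi (endo_letter i) : T) * pi (endo_letter i) = 1.
Proof.
rewrite pi_endo_letter; case: ifP => _; last exact: twin_genK.
rewrite -!mulgA (mulgA (twin_gen i1) (twin_gen i1)) twin_genK mul1g.
by rewrite (mulgA (twin_gen i0) (twin_gen i0)) twin_genK mul1g twin_genK.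
Qed.

Lemma pi_endo_letter_comm (i j : I) : i.+2 <= j ->
  (pi (endo_letter i) : T) * pi (endo_letter j) =
  (pi (endo_letter j) : T) * pi (endo_letter i).
Proof.
move=> ij; rewrite !pi_endo_letter.
(* Since [j] is at least 2, only [i] can be the index of s_2; in that case [j] is at least 3 and its
   generator commutes with both s_1 and s_2. *)
have /negPf -> : j != i1 by apply: contraTneq ij => ->.
case: eqP ij => [->|_] ij; last by apply: twin_gen_comm; rewrite ij.
have C1 : twin_gen i1 * twin_gen j = twin_gen j * twin_gen i1.
  by apply: twin_gen_comm; rewrite ij.
have C0 : twin_gen i0 * twin_gen j = twin_gen j * twin_gen i0.
  by apply: twin_gen_comm; rewrite (ltnW ij).
by rewrite -!mulgA C1 (mulgA (twin_gen i0)) C0 -(mulgA (twin_gen j)) !mulgA C1.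
Qed.

Lemma endo_word_eq (u v : word I) :
  presented_eq R u v -> presented_eq R (endo_word u) (endo_word v).
Proof.
(* Letters act by left multiplication by their images, so the value at 1 is the class of the image
   word. *)
pose act i (g : T) : T := (pi (endo_letter i) : T) * g.
have foldrE w : foldr (fun l => act l.1) 1 w = pi (endo_word w).
  by elim: w => //= l w ->; rewrite /act -twin_pi_cat.
move=> uv; apply/presented_piP; rewrite -!foldrE.
apply: twin_eq_foldr uv _ => [i g|i j ij g].
  by rewrite /act mulgA pi_endo_letterK mul1g.
by rewrite /act !mulgA pi_endo_letter_comm.
Qed.

Definition twin_endo (g : T) : T := pi (endo_word (repr g)).

Lemma twin_endo_pi (u : word I) : twin_endo (pi u) = pi (endo_word u).
Proof. exact/presented_piP/endo_word_eq/presented_reprP. Qed.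

Lemma twin_endoM : {morph twin_endo : g h / g * h}.
Proof.
elim/quotW=> u; elim/quotW=> v.
by rewrite -twin_pi_cat !twin_endo_pi endo_word_cat twin_pi_cat.
Qed.

HB.instance Definition _ := isMultiplicative.Build T T twin_endo twin_endoM.

Lemma twin_endo_not_surj (g : T) : twin_endo g <> twin_gen i1.
Proof.
(* The character in additive form: the parity of the number of letters s_2, of which s_2 s_1 s_2
   contains two. *)
pose act i := addb (i == i1).
have actE u v : presented_eq R u v ->
    foldr (fun l => act l.1) false u = foldr (fun l => act l.1) false v.
  by move=> uv; apply: twin_eq_foldr uv _ => [i b|i j _ b];
     rewrite /act ?addKb // addbCA.
have even_endo u : foldr (fun l => act l.1) false (endo_word u) = false.
  elim: u => //= l u IHu; rewrite /endo_word /= foldr_cat -/(endo_word u) IHu.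
  by rewrite /endo_letter; case: ifP => //= li; rewrite /act li.
elim/quotW: g => u; rewrite twin_endo_pi => /presented_piP/actE.
by rewrite even_endo.
Qed.

(* The component of index b of h s_(i+1); the value at i = i1, where h s_2 is
   the swap, is not used. *)
Definition wreath_comp (b : bool) (i : I) : T :=
  match nat_of_ord i, b with
  | 0, true => twin_gen i1
  | 2, true => 1
  | _, _ => twin_gen i
  end.

(** The bit names the copy of T, [false] being the first. *)
Definition wreath_act (i : I) (p : T * bool) : T * bool :=
  if i == i1 then (p.1, ~~ p.2) else (wreath_comp p.2 i * p.1, p.2).

Lemma wreath_compK (b : bool) (i : I) : wreath_comp b i * wreath_comp b i = 1.
Proof.
by rewrite /wreath_comp; case: (nat_of_ord i) b => [|[|[|k]]] [];
   rewrite ?twin_genK ?mulg1.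
Qed.

(** The delicate pair is s_1, s_3 in the second copy: the component of s_1 there is s_2, which does
    not commute with s_3, whence the component 1 for s_3. *)
Lemma wreath_comp_comm (b : bool) (i j : I) : i != i1 -> i.+2 <= j ->
  wreath_comp b i * wreath_comp b j = wreath_comp b j * wreath_comp b i.
Proof.
move=> ni ij; have C : twin_gen i * twin_gen j = twin_gen j * twin_gen i.
  by apply: twin_gen_comm; rewrite ij.
have C1 : 2 < j -> twin_gen i1 * twin_gen j = twin_gen j * twin_gen i1.
  by move=> lt2j; apply: twin_gen_comm; rewrite lt2j.
move: ni ij C1; rewrite /wreath_comp -val_eqE /=.
by case: (nat_of_ord i) (nat_of_ord j) b => [|[|[|k]]] [|[|[|l]]] [] //= _ _ C1;
   rewrite ?mulg1 ?mul1g ?C1.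
Qed.

Lemma wreath_actK (i : I) : involutive (wreath_act i).
Proof.
case=> g b; rewrite /wreath_act; case: eqP => _ /=; first by rewrite negbK.
by rewrite mulgA wreath_compK mul1g.
Qed.

Lemma wreath_act_comm (i j : I) : i.+2 <= j ->
  forall p, wreath_act i (wreath_act j p) = wreath_act j (wreath_act i p).
Proof.
move=> ij [g b]; rewrite /wreath_act.
have /negPf -> : j != i1 by apply: contraTneq ij => ->.
case: eqP ij => [->|/eqP ni] ij /=; last by rewrite !mulgA wreath_comp_comm.
(* Now [j] is at least 3, where both components agree, so the swap does not affect them. *)
congr (_ * _, _); rewrite /wreath_comp.
by case: (nat_of_ord j) ij b => [|[|[|k]]] // _ [].
Qed.

Lemma wreath_act_endo (u : word I) :
  foldr (fun l => wreath_act l.1) (1, false) (endo_word u) =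
  (pi u : T, false).
Proof.
elim: u => //= l u IHu; rewrite /endo_word /= foldr_cat -/(endo_word u) IHu.
rewrite -cat1s twin_pi_cat twin_pi_letter /endo_letter.
(* For s_2, the image word swaps to the second copy, multiplies by s_2, the component of s_1 there,
   and swaps back. Any other generator is its own first component. *)
case: ifP => [/eqP -> //|li]; rewrite /= /wreath_act li /wreath_comp /=.
by case: (nat_of_ord l.1) => [|[|[]]].
Qed.

Lemma twin_endo_inj : injective twin_endo.
Proof.
elim/quotW=> u; elim/quotW=> v; rewrite !twin_endo_pi => /presented_piP uv.
have := twin_eq_foldr wreath_actK wreath_act_comm uv (1, false).
by rewrite !wreath_act_endo => -[].
Qed.

End TwinGroup.

Theorem theorem5p1 (n : nat) (n_ge3 : 3 <= n) :
  ~ co_hopfian (twin_group n) /\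
  exists f : {multiplicative twin_group n -> twin_group n},
    injective f /\ ~ bijective f.
Proof.
have [f f_inj f_nbij] : exists2 f : {multiplicative twin_group n -> twin_group n},
    injective f & ~ bijective f.
  case: n n_ge3 => [|[|[|m]]] // _.
  exists (@twin_endo m : {multiplicative _ -> _}); first exact: twin_endo_inj.
  case=> f' _ f'K.
  by have /twin_endo_not_surj := f'K (twin_gen (Ordinal (isT : 1 < m.+2))).
by split=> [coH|]; [apply/f_nbij/coH | exists f].
Qed.
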